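(* Let $n\geq 1$. If $\mathcal{N}:L_n([0,1])\to L_n([0,1])$ is an $n$-dimensional strong fuzzy negation, then $\mathcal{N}$ preserves degenerate elements, i.e. $\mathcal{N}(/x/)\in\mathcal{D}_n$ for all $x\in[0,1]$.
   Context: $L_n([0,1])=\{(x_1,\ldots,x_n)\in[0,1]^n : x_1\leq\cdots\leq x_n\}$ with the componentwise order. For $x\in[0,1]$, $/x/=(x,\ldots,x)$; $\mathcal{D}_n=\{/x/ : x\in[0,1]\}$ is the set of degenerate elements. An $n$-dimensional fuzzy negation is a function $\mathcal{N}:L_n([0,1])\to L_n([0,1])$ with $\mathcal{N}(/0/)=/1/$, $\mathcal{N}(/1/)=/0/$ and $\mathcal{N}(\mathbf{x})\geq\mathcal{N}(\mathbf{y})$ whenever $\mathbf{x}\leq\mathbf{y}$. It is strong if $\mathcal{N}(\mathcal{N}(\mathbf{x}))=\mathbf{x}$ for all $\mathbf{x}\in L_n([0,1])$. *)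

(* Defs.v *)
From HB Require Import structures.
From mathcomp Require Import all_boot all_order all_algebra.
From mathcomp Require Import reals.
Set Implicit Arguments.
Unset Strict Implicit.
Unset Printing Implicit Defensive.
Import Order.TTheory GRing.Theory Num.Theory.
Local Open Scope ring_scope.

Definition in_L (R : realType) (n : nat) (x : {ffun 'I_n -> R}) : bool :=
  [forall i : 'I_n, 0 <= x i <= 1] &&
  [forall i : 'I_n, forall j : 'I_n, (i <= j)%N ==> (x i <= x j)].

(* L_n([0,1]): the membership predicate is boolean, so equality in [L R n] is equality of
   the underlying tuples. *)
Record L (R : realType) (n : nat) := MkL {
  Lval :> {ffun 'I_n -> R};
  LvalP : in_L Lval
}.

HB.instance Definition _ (R : realType) (n : nat) :=
  [isSub of L R n for @Lval R n].
HB.instance Definition _ (R : realType) (n : nat) :=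
  [Choice of L R n by <:].

Definition leL (R : realType) (n : nat) (x y : L R n) : Prop :=
  forall i : 'I_n, x i <= y i.

Lemma in_L_const (R : realType) (n : nat) (x : R) (hx : 0 <= x <= 1) :
  in_L [ffun _ : 'I_n => x].
Proof.
by apply/andP; split; apply/forallP => i; [|apply/forallP => j]; rewrite !ffunE // lexx implybT.
Qed.

(* The degenerate element /x/; the proof [hx] is irrelevant to equality. *)
Definition degen (R : realType) (n : nat) (x : R) (hx : 0 <= x <= 1) : L R n :=
  MkL (in_L_const n hx).

Lemma unit0 (R : realType) : 0 <= (0 : R) <= 1.
Proof. by rewrite lexx ler01. Qed.

Lemma unit1 (R : realType) : 0 <= (1 : R) <= 1.
Proof. by rewrite ler01 lexx. Qed.

Definition degenerate (R : realType) (n : nat) (y : L R n) : Prop :=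
  exists (x : R) (hx : 0 <= x <= 1), y = degen n hx.

Definition fuzzy_negation (R : realType) (n : nat) (N : L R n -> L R n) : Prop :=
  [/\ N (degen n (unit0 R)) = degen n (unit1 R),
      N (degen n (unit1 R)) = degen n (unit0 R)
    & forall x y : L R n, leL x y -> leL (N y) (N x)].

Definition strong_fuzzy_negation (R : realType) (n : nat)
    (N : L R n -> L R n) : Prop :=
  fuzzy_negation N /\ forall x : L R n, N (N x) = x.

(* Main.v *)
(* An order-reversing involution of L_n([0,1]) exchanges join-prime and
   meet-prime elements. A degenerate element is both, hence so is N(/x/), and an
   element which is both is either degenerate or has all its coordinates in
   {0,1}. The second kind cannot occur alone: /y/ is comparable with /x/, so
   N(/y/) is comparable with N(/x/), and the only degenerate elements comparable
   with a nonconstant 0-1 tuple are /0/ and /1/. Thus N would inject the infinite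
   set of degenerate elements into the finite set of 0-1 tuples. *)
Require Import Defs.
From HB Require Import structures.
From mathcomp Require Import all_boot all_order all_algebra.
From mathcomp Require Import reals.
Set Implicit Arguments.
Unset Strict Implicit.
Unset Printing Implicit Defensive.
Import Order.TTheory GRing.Theory Num.Theory.
Local Open Scope ring_scope.

Lemma in_LP (R : realType) (n : nat) (f : {ffun 'I_n -> R}) :
  reflect ((forall i, 0 <= f i <= 1) /\
           (forall i j : 'I_n, (i <= j)%N -> f i <= f j)) (in_L f).
Proof.
apply: (iffP andP) => -[f01 fmono]; split.
- exact/forallP.
- by move=> i j ij; move/forallP/(_ i)/forallP/(_ j)/implyP: fmono; apply.
- exact/forallP.
- by apply/forallP => i; apply/forallP => j; apply/implyP/fmono.
Qed.

Lemma L_bounds (R : realType) (n : nat) (x : L R n) i : 0 <= x i <= 1.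
Proof. by have /in_LP[] := LvalP x. Qed.

Lemma L_mono (R : realType) (n : nat) (x : L R n) (i j : 'I_n) :
  (i <= j)%N -> x i <= x j.
Proof. by have /in_LP[_] := LvalP x; apply. Qed.

Lemma L_ext (R : realType) (n : nat) (x y : L R n) :
  (forall i, x i = y i) -> x = y.
Proof. by move=> xy; apply/val_inj/ffunP. Qed.

Lemma degenE (R : realType) (n : nat) (a : R) (ha : 0 <= a <= 1) i :
  degen n ha i = a.
Proof. exact: ffunE. Qed.

Lemma const_degenerate (R : realType) (n : nat) (z : L R n) (k : 'I_n) :
  (forall i, z i = z k) -> degenerate z.
Proof.
move=> zk; exists (z k), (L_bounds z k).
by apply: L_ext => i; rewrite degenE.
Qed.

Lemma in_L_meet (R : realType) (n : nat) (x y : L R n) :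
  in_L [ffun i => Num.min (x i) (y i)].
Proof.
apply/in_LP; split=> [i|i j ij]; rewrite !ffunE.
  have /andP[x0 x1] := L_bounds x i; have /andP[y0 _] := L_bounds y i.
  by rewrite le_min x0 y0 ge_min x1.
by rewrite le_min !ge_min (L_mono x ij) (L_mono y ij) orbT.
Qed.

Lemma in_L_join (R : realType) (n : nat) (x y : L R n) :
  in_L [ffun i => Num.max (x i) (y i)].
Proof.
apply/in_LP; split=> [i|i j ij]; rewrite !ffunE.
  have /andP[x0 x1] := L_bounds x i; have /andP[_ y1] := L_bounds y i.
  by rewrite le_max x0 ge_max x1 y1.
by rewrite ge_max !le_max (L_mono x ij) (L_mono y ij) orbT.
Qed.

(** These 0-1 tuples, indicators of final segments of indices, are the test elements against which
    primeness is applied below. *)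
Lemma in_L_indicator (R : realType) (n : nat) (P : pred 'I_n) :
  (forall i j : 'I_n, (i <= j)%N -> P i -> P j) ->
  in_L [ffun i => (P i)%:R : R].
Proof.
move=> Pup; apply/in_LP; split=> [i|i j ij]; rewrite !ffunE.
  by rewrite ler0n lern1 leq_b1.
by rewrite ler_nat; case: (P i) (Pup _ _ ij) => // ->.
Qed.

Definition meetL (R : realType) (n : nat) (x y : L R n) := MkL (in_L_meet x y).
Definition joinL (R : realType) (n : nat) (x y : L R n) := MkL (in_L_join x y).

(** The bottom [/0/] is not excluded here, nor the top [/1/] in [meet_prime], so that every
    degenerate element has both properties. *)
Definition join_prime (R : realType) (n : nat) (z : L R n) : Prop :=
  forall u v, leL z (joinL u v) -> leL z u \/ leL z v.

Definition meet_prime (R : realType) (n : nat) (z : L R n) : Prop :=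
  forall u v, leL (meetL u v) z -> leL u z \/ leL v z.

Lemma leL_trans (R : realType) (n : nat) (x y z : L R n) :
  leL x y -> leL y z -> leL x z.
Proof. by move=> xy yz i; apply: le_trans (yz i). Qed.

(** Tuples increase, so whether [/a/] lies below a tuple is decided at the first coordinate, where
    the maximum is one of the two values. *)
Lemma join_prime_degen (R : realType) (n : nat) (a : R) (ha : 0 <= a <= 1) :
  (0 < n)%N -> join_prime (degen n ha).
Proof.
case: n => // n _ u v /(_ ord0); rewrite degenE ffunE le_max => /orP[] le_a.
  by left=> i; rewrite degenE (le_trans le_a) // L_mono.
by right=> i; rewrite degenE (le_trans le_a) // L_mono.
Qed.

(** Dually, lying below [/a/] is decided at the last coordinate. *)
Lemma meet_prime_degen (R : realType) (n : nat) (a : R) (ha : 0 <= a <= 1) :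
  (0 < n)%N -> meet_prime (degen n ha).
Proof.
case: n => // n _ u v /(_ ord_max); rewrite degenE ffunE ge_min => /orP[] ge_a.
  by left=> i; rewrite degenE (le_trans _ ge_a) // L_mono // leq_ord.
by right=> i; rewrite degenE (le_trans _ ge_a) // L_mono // leq_ord.
Qed.

(** [N] sends the meet of [N u] and [N v] to an upper bound of [u] and [v], hence of their join and
    of [N z]. Applying [N] again puts that meet below [z]. *)
Lemma strong_negation_join_prime (R : realType) (n : nat) (N : L R n -> L R n)
    (z : L R n) :
  strong_fuzzy_negation N -> meet_prime z -> join_prime (N z).
Proof.
move=> [[_ _ Nanti] NK] zP u v zuv.
have /zP : leL (meetL (N u) (N v)) z.
  have adj w : leL (meetL (N u) (N v)) (N w) -> leL w (N (meetL (N u) (N v))).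
    by move=> /Nanti; rewrite NK.
  rewrite -[z]NK -[meetL _ _]NK; apply: (Nanti); apply: leL_trans zuv _ => i.
  rewrite ffunE ge_max.
  by apply/andP; split; apply: adj => j; rewrite ffunE ge_min lexx ?orbT.
by case=> /Nanti; rewrite NK; [left|right].
Qed.

Lemma strong_negation_meet_prime (R : realType) (n : nat) (N : L R n -> L R n)
    (z : L R n) :
  strong_fuzzy_negation N -> join_prime z -> meet_prime (N z).
Proof.
move=> [[_ _ Nanti] NK] zP u v zuv.
have /zP : leL z (joinL (N u) (N v)).
  have adj w : leL (N w) (joinL (N u) (N v)) -> leL (N (joinL (N u) (N v))) w.
    by move=> /Nanti; rewrite NK.
  rewrite -[z]NK -[joinL _ _]NK; apply: (Nanti); apply: leL_trans zuv => i.
  rewrite ffunE le_min.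
  by apply/andP; split; apply: adj => j; rewrite ffunE le_max lexx ?orbT.
by case=> /Nanti; rewrite NK; [left|right].
Qed.

Lemma join_prime_coord (R : realType) (n : nat) (z : L R n) (k : 'I_n) :
  join_prime z -> z k = 0 \/ forall i, z i <= z k.
Proof.
move=> zP; have up (i j : 'I_n) : (i <= j)%N -> z k < z i -> z k < z j.
  by move=> ij /lt_le_trans; apply; apply: L_mono.
(* [z] lies below the join of [/z k/] and the indicator of [z k < z i]. *)
have [] := zP (degen n (L_bounds z k)) (MkL (in_L_indicator R up)).
- move=> i; rewrite ffunE degenE ffunE le_max.
  by case: leP => //= _; have /andP[] := L_bounds z i.
- by move=> zk; right=> i; have := zk i; rewrite degenE.
- move=> /(_ k); rewrite ffunE ltxx => zk0; left.
  by apply: le_anti; rewrite zk0; have /andP[] := L_bounds z k.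
Qed.

Lemma meet_prime_coord (R : realType) (n : nat) (z : L R n) (k : 'I_n) :
  meet_prime z -> z k = 1 \/ forall i, z k <= z i.
Proof.
move=> zP; have up (i j : 'I_n) : (i <= j)%N -> z k <= z i -> z k <= z j.
  by move=> ij /le_trans; apply; apply: L_mono.
(* [z] lies above the meet of [/z k/] and the indicator of [z k <= z i], whose value at [k] is 1. *)
have [] := zP (degen n (L_bounds z k)) (MkL (in_L_indicator R up)).
- move=> i; rewrite ffunE degenE ffunE ge_min.
  by case: leP => //= _; have /andP[] := L_bounds z i.
- by move=> zk; right=> i; have := zk i; rewrite degenE.
- move=> /(_ k); rewrite ffunE lexx => zk1; left.
  by apply: le_anti; rewrite zk1 andbT; have /andP[] := L_bounds z k.
Qed.

Definition crisp (R : realType) (n : nat) (z : L R n) : bool :=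
  [forall i, (z i == 0) || (z i == 1)].

Lemma crispP (R : realType) (n : nat) (z : L R n) :
  reflect (forall i, z i = 0 \/ z i = 1) (crisp z).
Proof.
apply: (iffP forallP) => z01 i.
  by have /orP[/eqP|/eqP] := z01 i; [left|right].
by case: (z01 i) => ->; rewrite eqxx ?orbT.
Qed.

(** A coordinate other than 0 and 1 is both the largest and the smallest one, which makes the tuple
    constant. *)
Lemma prime_degenerate_or_crisp (R : realType) (n : nat) (z : L R n) :
  join_prime z -> meet_prime z -> degenerate z \/ crisp z.
Proof.
move=> zJ zM; have [|/forallPn[k]] := boolP (crisp z); first by right.
rewrite negb_or => /andP[/eqP zk0 /eqP zk1]; left.
have [//|zle] := join_prime_coord k zJ.
have [//|zge] := meet_prime_coord k zM.
by apply: (const_degenerate (k := k)) => i; apply: le_anti; rewrite zle zge.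
Qed.

Lemma strong_negation_degen_or_crisp (R : realType) (n : nat)
    (N : L R n -> L R n) (a : R) (ha : 0 <= a <= 1) :
  (0 < n)%N -> strong_fuzzy_negation N ->
  degenerate (N (degen n ha)) \/ crisp (N (degen n ha)).
Proof.
move=> n0 hN; apply: prime_degenerate_or_crisp.
  by apply: strong_negation_join_prime => //; apply: meet_prime_degen.
by apply: strong_negation_meet_prime => //; apply: join_prime_degen.
Qed.

(** Such a [z] takes both values 0 and 1. Comparison at a coordinate of value 1 forces [a = 1] when
    [z] is below [/a/]; one of value 0 forces [a = 0] when it is above. *)
Lemma crisp_comparable_degen (R : realType) (n : nat) (z : L R n)
    (a : R) (ha : 0 <= a <= 1) :
  crisp z -> ~ degenerate z ->
  leL z (degen n ha) \/ leL (degen n ha) z -> crisp (degen n ha).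
Proof.
move=> /crispP z01 zND cmp; have /andP[a0 a1] := ha.
suff: a = 0 \/ a = 1 by move=> a01; apply/crispP => i; rewrite degenE.
have [/existsP[k /eqP zk0]|/existsPn z0] := boolP [exists k, z k == 0]; last first.
  case: zND; exists 1, (unit1 R); apply: L_ext => i; rewrite degenE.
  by case: (z01 i) => // zi; have := z0 i; rewrite zi eqxx.
have [/existsP[l /eqP zl1]|/existsPn z1] := boolP [exists l, z l == 1]; last first.
  case: zND; exists 0, (unit0 R); apply: L_ext => i; rewrite degenE.
  by case: (z01 i) => // zi; have := z1 i; rewrite zi eqxx.
case: cmp => [/(_ l)|/(_ k)]; rewrite degenE ?zl1 ?zk0 => le_a.
  by right; apply: le_anti; rewrite a1 le_a.
by left; apply: le_anti; rewrite a0 le_a.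
Qed.

Lemma crisp_inj (R : realType) (n : nat) (z w : L R n) :
  crisp z -> crisp w ->
  [ffun i => z i == 1] = [ffun i => w i == 1] -> z = w.
Proof.
move=> /crispP z01 /crispP w01 /ffunP zw; apply: L_ext => i.
have := zw i; rewrite !ffunE.
by case: (z01 i) (w01 i) => -> [] -> //; rewrite eqxx eq_sym oner_eq0.
Qed.

Lemma unit_invS (R : realType) (k : nat) : 0 <= (k.+1%:R^-1 : R) <= 1.
Proof. by rewrite invr_ge0 ler0n invf_le1 ?ltr0n // ler1n. Qed.

Lemma strong_negation_not_all_crisp (R : realType) (n : nat)
    (N : L R n -> L R n) :
  (0 < n)%N -> strong_fuzzy_negation N ->
  ~ (forall (a : R) (ha : 0 <= a <= 1), crisp (N (degen n ha))).
Proof.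
case: n N => // n N _ [_ NK] Ncrisp.
(* Pigeonhole: the points [1/(k+1)] are taken for one more index than there are 0-1 patterns. *)
pose f (k : 'I_(#|{ffun 'I_n.+1 -> bool}|.+1)) : {ffun 'I_n.+1 -> bool} :=
  [ffun i => N (degen n.+1 (unit_invS R k)) i == 1].
suff /leq_card : injective f by rewrite card_ord ltnn.
move=> k l /(crisp_inj (Ncrisp _ _) (Ncrisp _ _)) /(can_inj NK) kl.
have : degen n.+1 (unit_invS R k) ord0 = degen n.+1 (unit_invS R l) ord0.
  by rewrite kl.
by rewrite !degenE => /invr_inj /eqP; rewrite eqr_nat eqSS => /eqP /val_inj.
Qed.

Theorem corollary22 (R : realType) (n : nat) (hn : (1 <= n)%N)
    (N : L R n -> L R n) (hN : strong_fuzzy_negation N)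
    (x : R) (hx : 0 <= x <= 1) :
  degenerate (N (degen n hx)).
Proof.
have [//|xC] := strong_negation_degen_or_crisp hx hn hN.
(* The split is on constancy, a boolean condition, because [degenerate] quantifies over reals. *)
have [/existsP[k /forallP zk]|/existsPn zN] :=
  boolP [exists k, [forall i, N (degen n hx) i == N (degen n hx) k]].
  by apply: (const_degenerate (k := k)) => i; apply/eqP.
have xND : ~ degenerate (N (degen n hx)).
  move=> [c [hc xE]]; have /forallPn[i] := zN (Ordinal hn).
  by rewrite xE !degenE eqxx.
(* It remains to show that a crisp nondegenerate [N(/x/)] would make every [N(/y/)] crisp. *)
case: (strong_negation_not_all_crisp hn hN) => y hy.
have [[c [hc yE]]|//] := strong_negation_degen_or_crisp hy hn hN.
rewrite yE; apply: crisp_comparable_degen xC xND _; rewrite -yE.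
have [[_ _ Nanti] _] := hN.
by have [xy|/ltW yx] := leP x y; [right|left]; apply: Nanti => i; rewrite !degenE.
Qed.
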